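(* Let $X_1,X_2,Y$ be real Banach spaces, let $X=X_1\oplus_\infty X_2$, let $T: X\to Y$ be a bounded linear operator, and let $T_1: X_1\to Y$, $T_1x_1=T(x_1,0)$, and $T_2: X_2\to Y$, $T_2x_2=T(0,x_2)$, be its restrictions. If $T_1$ is a narrow operator on $X_1$ and $T_2$ is a narrow operator on $X_2$, then $T$ is a narrow operator on $X$.
   Context: All Banach spaces are real; $S(X)$ denotes the unit sphere of $X$. $X_1\oplus_\infty X_2$ is the direct sum with norm $\|(x_1,x_2)\|=\max\{\|x_1\|,\|x_2\|\}$. A bounded linear operator $T$ from a Banach space $X$ to some Banach space $Y$ is called a narrow operator (on $X$) if for all $x,y\in S(X)$, every $x^*\in X^*$ and every $\varepsilon>0$ there is $z\in S(X)$ with $\|x+z\|\ge 2-\varepsilon$ and $\|T(y-z)\|+|x^*(y-z)|\le\varepsilon$. *)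

(* Defs.v *)
From HB Require Import structures.
From mathcomp Require Import all_boot all_order all_algebra.
From mathcomp Require Import all_classical all_reals all_analysis.
Set Implicit Arguments.
Unset Strict Implicit.
Unset Printing Implicit Defensive.
Import Order.TTheory GRing.Theory Num.Theory.
Import numFieldNormedType.Exports.
Local Open Scope classical_set_scope.
Local Open Scope ring_scope.

(* Real Banach spaces are [completeNormedModType R] with [R : realType].  The
   l_infinity-sum of X1 and X2 is the library's product [(X1 * X2)%type], whose
   norm is the maximum of the norms of the components ([prod_normE]).  The
   library has no completeness instance for it, so it is supplied here. *)
Section prod_complete.
Variables (R : realType) (X1 X2 : completeNormedModType R).

HB.instance Definition _ := Pointed.on (X1 * X2)%type.

Lemma prod_complete (F : set_system (X1 * X2)%type) :
  ProperFilter F -> cauchy F -> cvg F.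
Proof.
move=> FF Fc.
have c1 : cauchy (fst @ F).
  apply/cauchy_ballP => e e0; move/cauchy_ballP: Fc => /(_ e e0) [[A B]/= [FA FB] AB].
  exists (fst @` A, fst @` B) => /=.
    by split; [apply: filterS FA | apply: filterS FB] => x Px; exists x.
  by move=> [_ _] /= [[x Ax <-] [y By <-]]; have [] := AB (x, y) (conj Ax By).
have c2 : cauchy (snd @ F).
  apply/cauchy_ballP => e e0; move/cauchy_ballP: Fc => /(_ e e0) [[A B]/= [FA FB] AB].
  exists (snd @` A, snd @` B) => /=.
    by split; [apply: filterS FA | apply: filterS FB] => x Px; exists x.
  by move=> [_ _] /= [[x Ax <-] [y By <-]]; have [] := AB (x, y) (conj Ax By).
have /cvg_ex[l1 Fl1] := @cauchy_cvg X1 _ (fmap_proper_filter fst FF) c1.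
have /cvg_ex[l2 Fl2] := @cauchy_cvg X2 _ (fmap_proper_filter snd FF) c2.
apply/cvg_ex; exists (l1, l2) => P [[A B]/= [Al Bl] ABP].
have FA : F (fst @^-1` A) := Fl1 _ Al.
have FB : F (snd @^-1` B) := Fl2 _ Bl.
by apply: filterS (filterI FA FB) => -[x y] [/= Ax By]; apply: ABP.
Qed.

HB.instance Definition _ := Uniform_isComplete.Build (X1 * X2)%type
  prod_complete.

End prod_complete.

Section operators.
Variable R : realType.

Definition unit_sphere (X : normedModType R) : set X := [set x | `|x| = 1].

(* [bounded_near T (nbhs 0)]: T is bounded on some neighbourhood of 0; for
   linear T this is boundedness of the operator ([linear_boundedP]). *)
Definition bounded_operator (X Y : normedModType R) (T : {linear X -> Y}) :=
  bounded_near T (nbhs (0 : X)).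

(* The functional x^* ranges over the dual of X, that is, over the bounded
   linear maps from X to [R^o]. *)
Definition narrow (X Y : completeNormedModType R) (T : {linear X -> Y}) : Prop :=
  bounded_operator T /\
  forall x y : X, unit_sphere x -> unit_sphere y ->
  forall f : {linear X -> R^o}, bounded_operator f ->
  forall e : R, 0 < e ->
  exists z : X, [/\ unit_sphere z,
    2 - e <= `|x + z| & `|T (y - z)| + `|f (y - z)| <= e].

End operators.

Section restrictions.
Variables (R : realType) (X1 X2 Y : completeNormedModType R).
Variable T : {linear (X1 * X2)%type -> Y}.

Definition restr1 (x1 : X1) : Y := T (x1, 0).
Definition restr2 (x2 : X2) : Y := T (0, x2).

Lemma restr1_linear : linear restr1.
Proof.
by move=> a u v; rewrite /restr1 -linearP; congr (T (_, _)); rewrite /= scaler0 addr0.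
Qed.

Lemma restr2_linear : linear restr2.
Proof.
by move=> a u v; rewrite /restr2 -linearP; congr (T (_, _)); rewrite /= scaler0 addr0.
Qed.

HB.instance Definition _ := GRing.isLinear.Build R X1 Y _ restr1 restr1_linear.
HB.instance Definition _ := GRing.isLinear.Build R X2 Y _ restr2 restr2_linear.

End restrictions.

(* Main.v *)
Require Import Defs.
From HB Require Import structures.
From mathcomp Require Import all_boot all_order all_algebra.
From mathcomp Require Import all_classical all_reals all_analysis.
From mathcomp Require Import lra.
Import Order.TTheory GRing.Theory Num.Theory.
Import numFieldNormedType.Exports.
Local Open Scope ring_scope.

(** Suppose [x = (x1, x2)] has norm 1 because [`|x1| = 1], and let
    [y = (y1, y2)] be a second unit vector.  It is enough to move the first
    coordinate: if [`|z1| <= 1], with equality when [`|y1| = 1], if [`|x1 + z1|]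
    is nearly 2 and both [T (y1 - z1, 0)] and [f (y1 - z1, 0)] are small, then
    [z = (z1, y2)] works, because the maximum norm of [x + z] is at least
    [`|x1 + z1|].

    The obstacle is that [y1] may lie strictly inside the unit ball (with
    [`|y2| = 1]), whereas narrowness of [T_1] only speaks of unit vectors.
    [narrow_ball] removes it: [y1] is a convex combination of antipodal unit
    vectors [u] and [- u]; narrowness replaces [u] by some [u'], then [- u] by
    some [v'], the second time relative to the direction of [x1 + l u'].
    Since near equality in the triangle inequality is stable under positive
    rescaling of the vectors ([almost_additive_scale]), the combination of [u']
    and [v'] is still almost additive with [x1]. *)

Section almost_additive.
Variables (R : realType) (X : normedModType R).

(** Scaling multiplies the defect [2 - `|x + v|] by at most [max a b]: if
    [b <= a], then [a *: x + b *: v] differs from [a *: (x + v)] by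
    [(a - b) *: v], which costs only the norm [a - b]. *)
Lemma almost_additive_scale (x v : X) (a b c d : R) :
  0 <= a <= c -> 0 <= b <= c -> `|x| <= 1 -> `|v| <= 1 ->
  0 <= d -> 2 - d <= `|x + v| -> a + b - c * d <= `|a *: x + b *: v|.
Proof.
move=> /andP[a0 ac] /andP[b0 bc] x1 v1 d0 xv.
wlog ab : a b x v a0 ac b0 bc x1 v1 xv / b <= a.
  move=> W; case: (leP b a) => [|/ltW] ab; first exact: W.
  by rewrite (addrC a) (addrC (a *: x)); apply: W; rewrite // (addrC v).
have tri : `|a *: (x + v)| <= `|a *: x + b *: v| + `|(a - b) *: v|.
  have -> : a *: (x + v) = (a *: x + b *: v) + (a - b) *: v.
    by rewrite scalerBl -addrA (addrC (b *: v)) subrK scalerDr.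
  exact: ler_normD.
rewrite !normrZ (ger0_norm a0) (@ger0_norm _ (a - b)) ?subr_ge0 // in tri.
have h1 : a * (2 - d) <= a * `|x + v| by rewrite ler_wpM2l.
have h2 : (a - b) * `|v| <= a - b by rewrite ler_piMr // subr_ge0.
have h3 : a * d <= c * d by rewrite ler_wpM2r.
lra.
Qed.

End almost_additive.

Section narrow_ball.
Variables (R : realType) (X Y : completeNormedModType R) (T : {linear X -> Y}).

Lemma ball_convex_antipodal (x y : X) : `|x| = 1 -> `|y| <= 1 ->
  exists u (l : R), [/\ `|u| = 1, 1 / 2 <= l <= 1 & y = l *: u + (1 - l) *: - u].
Proof.
move=> x1 y1.
have [u u1 yu] : exists2 u, `|u| = 1 & y = `|y| *: u.
  have [->|y0] := eqVneq y 0; first by exists x; rewrite // normr0 scale0r.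
  have ny0 : `|y| != 0 by rewrite normr_eq0.
  exists (`|y|^-1 *: y); last by rewrite scalerA divff // scale1r.
  by rewrite normrZ normfV normr_id mulVf.
exists u, ((1 + `|y|) / 2); split=> //.
  by apply/andP; split; have := normr_ge0 y; lra.
rewrite scalerN -scalerBl {1}yu; congr (_ *: _); lra.
Qed.

(** Narrowness extends from targets [y] on the sphere to targets in the ball,
    at the price of [z] being only in the ball when [y] is. *)
Lemma narrow_ball (x y : X) (f : {linear X -> R^o}) (e : R) :
  narrow T -> bounded_operator f -> `|x| = 1 -> `|y| <= 1 -> 0 < e ->
  exists z : X, [/\ `|z| <= 1, `|y| = 1 -> `|z| = 1,
    2 - e <= `|x + z| & `|T (y - z)| + `|f (y - z)| <= e].
Proof.
move=> [_ Tnar] bf x1 y1 e0.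
have [y1'|yn1] := eqVneq `|y| 1.
  have [z [z1 xz Tz]] := Tnar x y x1 y1' f bf e e0.
  by exists z; split=> //; rewrite z1.
have [u [l [u1 /andP[l2 l1] yE]]] := ball_convex_antipodal _ _ x1 y1.
have l0 : 0 <= l by lra.
(* The first step costs a defect [d], the second one [2 * d] because
   [`|x + l *: u'|] may be close to 2; and [d < 1] keeps [x + l *: u'] away
   from 0, so that it can be normalised. *)
pose d := Num.min (e / 3) (1 / 2).
have d0 : 0 < d by rewrite lt_min; apply/andP; split; lra.
have de : d <= e / 3 by rewrite ge_min lexx.
have d2 : d <= 1 / 2 by rewrite ge_min lexx orbT.
have [u' [u'1 xu' Tu']] := Tnar x u x1 u1 f bf d d0.
rewrite /unit_sphere /= in u'1.
pose w := x + l *: u'.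
have w_ge : 1 + l - d <= `|w|.
  have := @almost_additive_scale _ _ x u' 1 l 1 d.
  rewrite scale1r mul1r; apply; rewrite ?x1 ?u'1 ?l0 ?ler01 ?lexx //.
  exact: ltW.
have w_le : `|w| <= 2.
  by rewrite (le_trans (ler_normD _ _))// normrZ x1 u'1 ger0_norm //; lra.
have w0 : `|w| != 0 by rewrite gt_eqF //; lra.
have w1 : `| `|w|^-1 *: w| = 1 by rewrite normrZ normfV normr_id mulVf.
have Nu1 : `| - u| = 1 by rewrite normrN.
have [v' [v'1 wv' Tv']] := Tnar _ _ w1 Nu1 f bf d d0.
rewrite /unit_sphere /= in v'1.
have comb (Z : normedModType R) (g : {linear X -> Z}) :
    `|g (y - (l *: u' + (1 - l) *: v'))|
      <= l * `|g (u - u')| + (1 - l) * `|g (- u - v')|.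
  have -> : y - (l *: u' + (1 - l) *: v')
      = l *: (u - u') + (1 - l) *: (- u - v').
    by rewrite yE !scalerBr opprD addrACA.
  rewrite linearD !linearZ (le_trans (ler_normD _ _)) // !normrZ.
  by rewrite !ger0_norm // subr_ge0.
exists (l *: u' + (1 - l) *: v'); split.
- rewrite (le_trans (ler_normD _ _)) // !normrZ u'1 v'1.
  by rewrite !ger0_norm ?subr_ge0 //; lra.
- by move=> yE1; rewrite yE1 eqxx in yn1.
- have : `|w| + (1 - l) - 2 * d
      <= `| `|w| *: (`|w|^-1 *: w) + (1 - l) *: v'|.
    apply: almost_additive_scale; rewrite ?w1 ?v'1 ?normr_ge0 ?(ltW d0) //.
    by apply/andP; split; lra.
  by rewrite scalerA divff // scale1r /w -(addrA x) -/w; lra.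
- have cT := comb _ T; have cf := comb _ f.
  have hu : l * (`|T (u - u')| + `|f (u - u')|) <= l * d by rewrite ler_wpM2l.
  have hv : (1 - l) * (`|T (- u - v')| + `|f (- u - v')|) <= (1 - l) * d.
    by rewrite ler_wpM2l // subr_ge0.
  lra.
Qed.

End narrow_ball.

Section bounded_restrictions.
Variables (R : realType) (X1 X2 Y : completeNormedModType R).
Variable T : {linear (X1 * X2)%type -> Y}.

Lemma bounded_restr1 : bounded_operator T -> bounded_operator (restr1 T).
Proof.
move=> /linear_boundedP [M [Mreal MT]]; apply/linear_boundedP.
exists M; split=> // r Mr x.
by have := MT r Mr (x, 0); rewrite prod_normE /= normr0 max_l.
Qed.

Lemma bounded_restr2 : bounded_operator T -> bounded_operator (restr2 T).
Proof.
move=> /linear_boundedP [M [Mreal MT]]; apply/linear_boundedP.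
exists M; split=> // r Mr x.
by have := MT r Mr (0, x); rewrite prod_normE /= normr0 max_r.
Qed.

End bounded_restrictions.

Theorem corollary3p2 (R : realType) (X1 X2 Y : completeNormedModType R)
    (T : {linear (X1 * X2)%type -> Y}) (hT : bounded_operator T)
    (h1 : narrow (restr1 T)) (h2 : narrow (restr2 T)) :
  narrow T.
Proof.
split=> // -[x1 x2] [y1 y2]; rewrite /unit_sphere /= !prod_normE /=.
move=> nx ny f bf e e0.
have y1_le : `|y1| <= 1 by rewrite -ny le_max lexx.
have y2_le : `|y2| <= 1 by rewrite -ny le_max lexx orbT.
have keep_max (a b a' : R) : Num.max a b = 1 -> a' <= 1 -> (a = 1 -> a' = 1) ->
    Num.max a' b = 1.
  move=> ab1 a'1 aa'; have b1 : b <= 1 by rewrite -ab1 le_max lexx orbT.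
  move: ab1; case: (leP a b) => [_ ->|_ /aa' ->]; first by rewrite max_r.
  by rewrite max_l.
case: (leP `|x2| `|x1|) nx => _ nx.
- have [z1 [z1_le z1_eq xz Tz]] :=
    @narrow_ball _ _ _ _ x1 y1 (restr1 f) e h1 (bounded_restr1 _ _ _ _ f bf) nx y1_le e0.
  exists (z1, y2); have -> : (y1, y2) - (z1, y2) = (y1 - z1, 0).
    by congr (_, _); rewrite /= subrr.
  split=> //; first by rewrite prod_normE /=; apply: keep_max ny _ _.
  by rewrite prod_normE /= le_max xz.
- have [z2 [z2_le z2_eq xz Tz]] :=
    @narrow_ball _ _ _ _ x2 y2 (restr2 f) e h2 (bounded_restr2 _ _ _ _ f bf) nx y2_le e0.
  exists (y1, z2); have -> : (y1, y2) - (y1, z2) = (0, y2 - z2).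
    by congr (_, _); rewrite /= subrr.
  split=> //.
    by rewrite prod_normE /= maxC; apply: keep_max z2_le z2_eq; rewrite maxC.
  by rewrite prod_normE /= le_max xz orbT.
Qed.
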